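(* For all $n\geq 1$, in terms of Pell numbers $P_k$: $$B_{n}^{neobc}=\frac{21P_{4n-2}-3P_{4n-4}+6}{8},\quad C_{n}^{neobc}=\frac{15P_{4n-2}-3P_{4n-4}}{2},$$ $$R_{n}^{neobc}=\frac{9P_{4n-2}-3P_{4n-4}-10}{8},\quad CR_{n}^{neobc}=\frac{3P_{4n-2}}{2}.$$
   Context: Pell numbers: $P_0=0$, $P_1=1$, $P_k=2P_{k-1}+P_{k-2}$. A positive integer $m$ is a neo balcobalancing number if there is a positive integer $r$ (its neo balcobalancer) such that $(1+2+\cdots+(m-1))+(1+2+\cdots+m)=2[(m-1)+m+(m+1)+(m+2)+\cdots+(m+r)]$; then $r=\frac{-2m-1+\sqrt{8m^2-12m+9}}{2}$ (equivalently, $m$ is a neo balcobalancing number iff $8m^2-12m+9$ is a perfect square). $B_n^{neobc}$ denotes the $n$-th neo balcobalancing number in increasing order ($n\ge1$), $R_n^{neobc}$ its neo balcobalancer, $C_n^{neobc}=\sqrt{8(B_n^{neobc})^2-12B_n^{neobc}+9}$ and $CR_n^{neobc}=\sqrt{2(R_n^{neobc})^2+5R_n^{neobc}+2}$. *)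

(* Defs.v *)
From mathcomp Require Import all_boot all_order all_algebra.
From mathcomp Require Import boolp classical_sets reals.
Set Implicit Arguments.
Unset Strict Implicit.
Unset Printing Implicit Defensive.
Import Order.TTheory GRing.Theory Num.Theory.

Fixpoint pell (k : nat) : nat :=
  match k with
  | 0 => 0
  | k1.+1 => match k1 with
             | 0 => 1
             | k2.+1 => 2 * pell k1 + pell k2
             end
  end.

Definition neo_balcobalancer (m r : nat) : Prop :=
  [/\ 0 < m, 0 < r &
      \sum_(1 <= i < m) i + \sum_(1 <= i < m.+1) i
      = 2 * \sum_(m.-1 <= i < (m + r).+1) i].

Definition neo_balcobalancing (m : nat) : Prop :=
  exists r : nat, neo_balcobalancer m r.

Definition nth_neo_balcobalancing (n m : nat) : Prop :=
  neo_balcobalancing m /\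
  (count (fun k => `[< neo_balcobalancing k >]) (iota 0 m)).+1 = n.

(* [xget 0 A] is an element of [A], and 0 if [A] is empty. As 0 is neither a
   neo balcobalancing number nor a neo balcobalancer, the default value can
   not be confused with a genuine one. *)
Definition Bneobc (n : nat) : nat :=
  xget 0 (fun m => nth_neo_balcobalancing n m).

Definition Rneobc (n : nat) : nat :=
  xget 0 (fun r => neo_balcobalancer (Bneobc n) r).

Local Open Scope ring_scope.

Definition Cneobc (R : realType) (n : nat) : R :=
  Num.sqrt (8 * (Bneobc n)%:R ^+ 2 - 12 * (Bneobc n)%:R + 9).

Definition CRneobc (R : realType) (n : nat) : R :=
  Num.sqrt (2 * (Rneobc n)%:R ^+ 2 + 5 * (Rneobc n)%:R + 2).

(* Main.v *)
Require Import Defs.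
From mathcomp Require Import all_boot all_order all_algebra.
From mathcomp Require Import boolp classical_sets reals.
From mathcomp Require Import zify lra.
Import Order.TTheory GRing.Theory Num.Theory.

(** With [s = r + 2] the defining equation reads [m^2 + 3s = s(2m + s)].
    Reduction modulo 3 gives [m = 3u] and [s = 3a], whence
    [u^2 = a(2u + a - 1)].  Since [u] is prime to [2u - 1], the two factors are
    coprime, so [a = x^2] and [u = xv] with [v^2 - 2xv - x^2 = -1].  By descent
    along [(x, v) |-> (v - 2x, x)], such pairs [(x, v)] consist of consecutive
    Pell numbers; hence the [n]-th neo balcobalancing number is
    [3 P_(2n-1) P_(2n)], with balancer [3 P_(2n-1)^2 - 2].  Moreover
    [8m^2 - 12m + 9] and [2r^2 + 5r + 2] are the squares of [2(m + r) + 1] and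
    [m - r - 2]. *)

Lemma sum_consecutive (k n : nat) :
  2 * \sum_(k <= i < k + n) i + n = n * (2 * k + n).
Proof.
elim: n => [|n IHn]; first by rewrite big_geq // addn0.
by rewrite (addnS k) big_nat_recr ?leq_addr //=; lia.
Qed.

Lemma expn_gcd (k m n : nat) : gcdn m n ^ k = gcdn (m ^ k) (n ^ k).
Proof.
set g := gcdn m n; have [/eqP|g_gt0] := posnP g.
  rewrite eqn0Ngt gcdn_gt0 negb_or -!eqn0Ngt => /andP[/eqP m0 /eqP n0].
  by rewrite /g m0 n0 !gcdnn.
have /dvdnP[p mE] : g %| m := dvdn_gcdl m n.
have /dvdnP[q nE] : g %| n := dvdn_gcdr m n.
have pq_coprime : coprime p q.
  by rewrite /coprime -(eqn_pmul2r g_gt0) muln_gcdl -mE -nE mul1n.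
rewrite mE nE !expnMn -muln_gcdl.
by have /eqP -> := coprimeXl k (coprimeXr k pq_coprime); rewrite mul1n.
Qed.

Lemma coprime_mul_expn (k a b c : nat) :
  coprime a b -> a * b = c ^ k -> a = gcdn a c ^ k.
Proof.
case: k => [_ /eqP|k ab_coprime abE]; first by rewrite muln_eq1 => /andP[/eqP].
rewrite expn_gcd -abE expnS -muln_gcdr.
suff /eqP -> : coprime (a ^ k) b by rewrite muln1.
exact: coprimeXl.
Qed.

Lemma dvdn3_sum_squares (s t : nat) :
  (3 %| s ^ 2 + t ^ 2) = (3 %| s) && (3 %| t).
Proof.
rewrite /dvdn -modnDm -(modnXm 2 3 s) -(modnXm 2 3 t).
move: (s %% 3) (t %% 3) (ltn_pmod s (isT : 0 < 3)) (ltn_pmod t (isT : 0 < 3)).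
by move=> [|[|[|]]] // [|[|[|]]].
Qed.

Lemma count_iota_homo_ltn (P : pred nat) (f : nat -> nat) (k : nat) :
  {homo f : i j / i < j} -> (forall m, P m <-> exists i, m = f i) ->
  count P (iota 0 (f k)) = k.
Proof.
move=> /leq_mono f_mono PE.
rewrite -size_filter -[RHS](size_iota 0 k) -[RHS](size_map f).
apply/perm_size/uniq_perm.
- by rewrite filter_uniq ?iota_uniq.
- by rewrite map_inj_uniq ?iota_uniq //; apply: incn_inj.
move=> m; rewrite mem_filter mem_iota /= add0n.
apply/andP/mapP => [[/PE[i ->]]|[i]].
  by rewrite (leqW_mono f_mono) => ik; exists i; rewrite ?mem_iota.
rewrite mem_iota => ik ->; rewrite (leqW_mono f_mono).
by split=> //; apply/PE; exists i.
Qed.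

Lemma pellSS (k : nat) : pell k.+2 = 2 * pell k.+1 + pell k.
Proof. by []. Qed.

Lemma pell_gt0 (k : nat) : 0 < pell k.+1.
Proof. by elim: k => // k IHk; rewrite pellSS; lia. Qed.

Lemma pellD (m n : nat) :
  pell (m + n).+1 = pell m.+1 * pell n.+1 + pell m * pell n.
Proof.
elim/ltn_ind: m => -[|[|m]] IHm.
- by rewrite add0n mul1n addn0.
- by rewrite add1n pellSS !mul1n.
by rewrite !addSn pellSS -addSn !IHm // !pellSS; lia.
Qed.

Lemma pell_double (n : nat) :
  pell n.*2 + 2 * pell n ^ 2 = 2 * (pell n * pell n.+1).
Proof.
case: n => // n; rewrite doubleS -addnn -addSn pellD !pellSS; lia.
Qed.

(* The summands [2 * odd k] and [1] encode the sign [(-1)^k] of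
   [v^2 - 2xv - x^2] at [(x, v) = (P_k, P_(k+1))] without subtraction. *)
Lemma pell_cassini (k : nat) :
  pell k.+1 ^ 2 + 2 * odd k = 2 * (pell k * pell k.+1) + pell k ^ 2 + 1.
Proof.
by elim: k => // k IHk; rewrite pellSS /=; case: odd IHk => /= IHk; nia.
Qed.

Lemma pell_succ_sqr (n : nat) :
  8 * pell n.+1 ^ 2 + pell n.*2 + 4 * odd n = 3 * pell n.+1.*2 + 2.
Proof.
have := pell_double n; have := pell_double n.+1; have := pell_cassini n.
by rewrite (pellSS n); nia.
Qed.

Lemma pell_succ_mul (n : nat) :
  8 * (pell n.+1 * pell n.+2) + pell n.*2 + 4 * odd n = 7 * pell n.+1.*2 + 2.
Proof.
have := pell_double n.+1; have := pell_succ_sqr n.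
by rewrite (pellSS n); nia.
Qed.

Lemma pell_cassini_inv (e : bool) (x v : nat) :
  0 < v -> v ^ 2 + 2 * e = 2 * (x * v) + x ^ 2 + 1 ->
  exists k, [/\ odd k = e, x = pell k & v = pell k.+1].
Proof.
elim/ltn_ind: v => v IHv in e x *; move=> v_gt0 xvE.
have [x0|x_gt0] := posnP x.
  by exists 0; split=> //=; subst x; case: e xvE; nia.
have xv_le : 2 * x <= v by case: e xvE => /=; nia.
pose y := v - 2 * x; have vE : v = 2 * x + y by rewrite subnKC.
have yxE : x ^ 2 + 2 * ~~ e = 2 * (y * x) + y ^ 2 + 1.
  by move: xvE; rewrite vE; case: (e) => /=; nia.
have [k [kE yE xE]] := IHv x ltac:(lia) (~~ e) y x_gt0 yxE.
by exists k.+1; rewrite pellSS -xE -yE /= kE negbK vE.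
Qed.

Lemma neo_balcobalancerE (m r : nat) : neo_balcobalancer m r <->
  [/\ 0 < m, 0 < r & m ^ 2 + 3 * r.+2 = r.+2 * (2 * m + r.+2)].
Proof.
case: m => [|m]; first by split=> -[].
have := sum_consecutive m r.+2; have := sum_consecutive 1 m.+1.
have := sum_consecutive 1 m.
rewrite /neo_balcobalancer succnK !add1n addSn -2!addnS => sum_m sum_m1 sum_r.
by split=> -[m_gt0 r_gt0 mrE]; split=> //; lia.
Qed.

Lemma neo_balcobalancer_leq (m r : nat) : neo_balcobalancer m r -> r.+2 <= m.
Proof. by move=> /neo_balcobalancerE[]; nia. Qed.

Lemma reduced_neo_balcobalancing_pell (u a : nat) :
    0 < u -> 0 < a -> u ^ 2 + a = a * (2 * u + a) ->
  exists k, u = pell k.*2.+1 * pell k.*2.+2 /\ a = pell k.*2.+1 ^ 2.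
Proof.
move=> u_gt0 a_gt0 uaE.
have factE : a * (u + u.-1 + a) = u ^ 2 by nia.
have a_coprime : coprime a (u + u.-1 + a).
  rewrite /coprime gcdnDr; apply: (coprime_dvdl (n := u ^ 2)).
    by rewrite -factE dvdn_mulr.
  by rewrite coprimeXl // /coprime gcdnDl -/(coprime _ _) coprime_sym coprimePn.
have aE := coprime_mul_expn _ _ _ _ a_coprime factE.
have /dvdnP[v] := dvdn_gcdr a u; set x := gcdn a u in aE * => uE.
have x2_gt0 : 0 < x ^ 2 by rewrite -aE.
have xvE : v ^ 2 + 2 * true = 2 * (x * v) + x ^ 2 + 1.
  by apply/eqP; rewrite -(eqn_pmul2l x2_gt0); rewrite uE aE in uaE; lia.
have v_gt0 : 0 < v by move: u_gt0; rewrite uE muln_gt0 => /andP[].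
have [k [k_odd xE vE]] := pell_cassini_inv true x v v_gt0 xvE.
have kE : k = k./2.*2.+1 by rewrite -[LHS]odd_double_half k_odd.
by exists k./2; rewrite -kE -xE -vE mulnC.
Qed.

Definition neob (k : nat) : nat := 3 * (pell k.*2.+1 * pell k.*2.+2).

Lemma neo_balcobalancer_pell (m r : nat) : neo_balcobalancer m r <->
  exists k, m = neob k /\ r.+2 = 3 * pell k.*2.+1 ^ 2.
Proof.
rewrite neo_balcobalancerE; split=> [[m_gt0 _ mrE]|[k [-> rE]]]; last first.
  have := pell_cassini k.*2.+1; rewrite [odd _]/= odd_double /neob rE.
  have := pell_gt0 k.*2; have := pell_gt0 k.*2.+1.
  move: (pell k.*2.+1) (pell k.*2.+2) rE => x v rE v_gt0 x_gt0 xvE.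
  by split; [nia | nia | have := congr1 (muln (x ^ 2)) xvE; lia].
have /andP[dvd_m dvd_r] : (3 %| m + 2 * r.+2) && (3 %| r.+2).
  rewrite -dvdn3_sum_squares -(dvdn_addl _ (dvdn_mulr r.+2 (dvdnn 3))).
  by apply/dvdnP; exists (2 * (m * r.+2) + 2 * r.+2 ^ 2); nia.
have /dvdnP[u mE] : 3 %| m by rewrite -(dvdn_addl _ (dvdn_mull 2 dvd_r)).
have /dvdnP[a rE] := dvd_r.
rewrite mE rE in mrE *.
have [|||k [-> ->]] := reduced_neo_balcobalancing_pell u a; [lia | lia | nia |].
by exists k; rewrite /neob !(mulnC 3).
Qed.

Lemma neob_ltn_homo : {homo neob : i j / i < j}.
Proof.
apply: homo_ltn => [|k]; first exact: ltn_trans.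
rewrite /neob doubleS; have := pell_gt0 k.*2; have := pell_gt0 k.*2.+1.
by rewrite (pellSS k.*2.+2) (pellSS k.*2.+1); nia.
Qed.

Lemma neo_balcobalancing_neob (m : nat) :
  neo_balcobalancing m <-> exists k, m = neob k.
Proof.
split=> [[r /neo_balcobalancer_pell[k [-> _]]]|[k ->]]; first by exists k.
exists (3 * pell k.*2.+1 ^ 2).-2; apply/neo_balcobalancer_pell; exists k.
by split=> //; have := pell_gt0 k.*2; nia.
Qed.

Lemma nth_neo_balcobalancing_neob (k m : nat) :
  nth_neo_balcobalancing k.+1 m <-> m = neob k.
Proof.
have count_neob j :
    count (fun m => `[< neo_balcobalancing m >]) (iota 0 (neob j)) = j.
  apply: count_iota_homo_ltn neob_ltn_homo _ => i.
  by rewrite -neo_balcobalancing_neob; split=> /asboolP.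
split=> [[/neo_balcobalancing_neob[j ->]]|->].
  by rewrite count_neob => -[->].
by split; [apply/neo_balcobalancing_neob; exists k | rewrite count_neob].
Qed.

Lemma Bneobc_neob (k : nat) : Bneobc k.+1 = neob k.
Proof.
apply: xget_unique; first exact/nth_neo_balcobalancing_neob.
by move=> m /nth_neo_balcobalancing_neob.
Qed.

Lemma neo_balcobalancer_Rneobc (k : nat) :
  neo_balcobalancer (Bneobc k.+1) (Rneobc k.+1).
Proof.
apply: (@xgetPex _ 0 (neo_balcobalancer (Bneobc k.+1))).
by apply/neo_balcobalancing_neob; exists k; apply: Bneobc_neob.
Qed.

Lemma Rneobc_pell (k : nat) : (Rneobc k.+1).+2 = 3 * pell k.*2.+1 ^ 2.
Proof.
have /neo_balcobalancer_pell[j [mE ->]] := neo_balcobalancer_Rneobc k.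
rewrite Bneobc_neob in mE.
by have -> : k = j := incn_inj (leq_mono neob_ltn_homo) mE.
Qed.

Local Open Scope ring_scope.

Lemma sqrt_neo_balcobalancing (R : rcfType) (m r : nat) :
  neo_balcobalancer m r ->
  Num.sqrt (8 * m%:R ^+ 2 - 12 * m%:R + 9) = 2 * (m%:R + r%:R) + 1 :> R.
Proof.
move=> /neo_balcobalancerE[_ _ /(congr1 (GRing.natmul (1 : R)))].
rewrite -[r.+2]addn2 !(natrD, natrM, natrX) => mrE.
have -> : 8 * m%:R ^+ 2 - 12 * m%:R + 9 = (2 * (m%:R + r%:R) + 1) ^+ 2 :> R.
  by lra.
by rewrite sqrtr_sqr ger0_norm // !(addr_ge0, mulr_ge0).
Qed.

Lemma sqrt_neo_balcobalancer (R : rcfType) (m r : nat) :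
  neo_balcobalancer m r ->
  Num.sqrt (2 * r%:R ^+ 2 + 5 * r%:R + 2) = m%:R - (r%:R + 2) :> R.
Proof.
move=> mr; have := neo_balcobalancer_leq _ _ mr.
move: mr => /neo_balcobalancerE[_ _ /(congr1 (GRing.natmul (1 : R)))].
rewrite -[r.+2]addn2 -(ler_nat R) !(natrD, natrM, natrX) => mrE rm_le.
have -> : 2 * r%:R ^+ 2 + 5 * r%:R + 2 = (m%:R - (r%:R + 2)) ^+ 2 :> R by lra.
by rewrite sqrtr_sqr ger0_norm // subr_ge0.
Qed.

Theorem theorem5p1 (R : realType) (n : nat) (hn : (1 <= n)%N) :
  [/\ (Bneobc n)%:R
        = (21 * (pell (4 * n - 2))%:R - 3 * (pell (4 * n - 4))%:R + 6) / 8 :> R,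
      Cneobc R n
        = (15 * (pell (4 * n - 2))%:R - 3 * (pell (4 * n - 4))%:R) / 2,
      (Rneobc n)%:R
        = (9 * (pell (4 * n - 2))%:R - 3 * (pell (4 * n - 4))%:R - 10) / 8 :> R
    & CRneobc R n = 3 * (pell (4 * n - 2))%:R / 2].
Proof.
case: n hn => // k _.
have balancer := neo_balcobalancer_Rneobc k.
rewrite /Cneobc (sqrt_neo_balcobalancing R _ _ balancer).
rewrite /CRneobc (sqrt_neo_balcobalancer R _ _ balancer).
have -> : (4 * k.+1 - 2 = k.*2.+1.*2)%N by lia.
have -> : (4 * k.+1 - 4 = k.*2.*2)%N by lia.
have BE : 8 * (Bneobc k.+1)%:R + 3 * (pell k.*2.*2)%:R
    = 21 * (pell k.*2.+1.*2)%:R + 6 :> R.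
  rewrite -!natrM -!natrD Bneobc_neob /neob.
  by congr _%:R; have := pell_succ_mul k.*2; rewrite odd_double; lia.
have RE : 8 * ((Rneobc k.+1)%:R + 2) + 3 * (pell k.*2.*2)%:R
    = 9 * (pell k.*2.+1.*2)%:R + 6 :> R.
  rewrite -natrD addn2 Rneobc_pell -!natrM -!natrD.
  by congr _%:R; have := pell_succ_sqr k.*2; rewrite odd_double; lia.
by split; lra.
Qed.
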